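(* Let $\widehat V\in\mathbb{C}^{n\times n}$ be invertible and let $\widehat W\in\mathbb{C}^{n\times n}$ be arbitrary. Define $\Delta:=\widehat W^{\mathrm H}\widehat V-I$. For any matrix $\widetilde E\in\mathbb{C}^{n\times n}$, define $F\in\mathbb{C}^{n\times n}$ by $$F^{\mathrm H}:=I-\widehat W^{\mathrm H}\widehat V-\widetilde E=-\Delta-\widetilde E,$$ and set $$\widetilde V:=\widehat V(I+\widetilde E),\qquad \widetilde W:=\widehat W(I+F),\qquad \widetilde\Delta:=\widetilde W^{\mathrm H}\widetilde V-I.$$ Then the exact identity $$\widetilde\Delta=-\widetilde E^2-\widetilde E\Delta-\Delta^2-\Delta^2\widetilde E-\widetilde E\Delta\widetilde E$$ holds. Consequently, for any submultiplicative matrix norm $\|\cdot\|$ on $\mathbb{C}^{n\times n}$, $$\|\widetilde\Delta\|\le(\|\widetilde E\|+\|\Delta\|)^2+(\|\widetilde E\|+\|\Delta\|)^3.$$ In particular, if $\widetilde E=0$, then $\widetilde W^{\mathrm H}\widehat V=I-\Delta^2$.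
   Context: The superscript $\mathrm H$ denotes the conjugate transpose. A matrix norm is submultiplicative if $\|XY\|\le\|X\|\,\|Y\|$ for all $X,Y\in\mathbb{C}^{n\times n}$. *)

(* Defs.v *)
From mathcomp Require Import all_boot all_order all_algebra.
From mathcomp Require Import sesquilinear spectral.
From mathcomp Require Import complex reals.

Set Implicit Arguments.
Unset Strict Implicit.
Unset Printing Implicit Defensive.

Import Order.TTheory GRing.Theory Num.Theory.
Local Open Scope ring_scope.
Local Open Scope complex_scope.

(* The norm on R[i] takes values in R[i], so homogeneity is stated there. *)
Record matrix_norm (R : realType) (n : nat) (nrm : 'M[R[i]]_n -> R) : Prop :=
  MatrixNorm {
    matrix_norm_ge0 : forall X, 0 <= nrm X ;
    matrix_norm_eq0 : forall X, nrm X = 0 <-> X = 0 ;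
    matrix_normZ : forall (a : R[i]) X, (nrm (a *: X))%:C = `|a| * (nrm X)%:C ;
    matrix_normD : forall X Y, nrm (X + Y) <= nrm X + nrm Y
  }.

Definition submultiplicative (R : realType) (n : nat)
    (nrm : 'M[R[i]]_n -> R) : Prop :=
  forall X Y, nrm (X *m Y) <= nrm X * nrm Y.

(* Main.v *)
Require Import Defs.
From mathcomp Require Import all_boot all_order all_algebra.
From mathcomp Require Import sesquilinear spectral.
From mathcomp Require Import complex reals.
From mathcomp Require Import ring.

Set Implicit Arguments.
Unset Strict Implicit.
Unset Printing Implicit Defensive.

Import Order.TTheory GRing.Theory Num.Theory.
Local Open Scope ring_scope.
Local Open Scope sesquilinear_scope.

(** With [D = W^H V - 1], the definition of [F] reads [1 + F^H = 1 - D - E].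
    Thus [W'^H V' = (1 + F^H) W^H V (1 + E)] is the product
    [(1 - D - E) (1 + D) (1 + E)], and the whole result is about this product.
    The factor [1 - D] is the first-order inverse of [1 + D], and [- E]
    anticipates the perturbation [1 + E] on the right.  Multiplying the first
    two factors cancels the linear term in [D] ([corrected_mul1D]), which is
    already the case [E = 0]; multiplying by [1 + E] cancels the linear term
    in [E] ([corrected_mul1D_mul1D]).  What is left is quadratic and cubic.
    These are identities in an arbitrary, possibly noncommutative ring.

    For the bound, the triangle inequality and submultiplicativity give
    [e^2 + e d + d^2 + d^2 e + e^2 d], where [e] and [d] are the norms of [E]
    and [D]; every monomial occurs in the expansion of
    [(e + d)^2 + (e + d)^3] with at least the same coefficient
    ([matrix_norm_residual_le]). *)

(** The difference of squares [(1 - D) (1 + D) = 1 - D^2], shifted by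
    [- E (1 + D)]; for [E = 0] it is one Newton step towards the inverse of
    [1 + D], squaring the residual up to sign. *)
Lemma corrected_mul1D (A : pzRingType) (D E : A) :
  (1 - D - E) * (1 + D) = 1 - D ^+ 2 - E - E * D.
Proof.
by rewrite !mulrBl mul1r !mulrDr !mulr1 -expr2 !opprD !addrA addrK.
Qed.

(** The [E] of the last factor meets the leading [1] of the product above and
    cancels its only linear term [- E]. *)
Lemma corrected_mul1D_mul1D (A : pzRingType) (D E : A) :
  (1 - D - E) * (1 + D) * (1 + E) - 1 =
  - E ^+ 2 - E * D - D ^+ 2 - D ^+ 2 * E - E * D * E.
Proof.
rewrite corrected_mul1D mulrDr mulr1 !mulrBl mul1r -[E * E]expr2 !addrA.
(* [ACl] lists the summands in their final order after the two pairs that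
   cancel, [1 - 1] and [- E + E]. *)
by rewrite (ACl ((1*9)*(3*5)*7*4*2*6*8)) /= subrr addNr !add0r.
Qed.

Lemma matrix_normN (R : realType) (n : nat) (nrm : 'M[R[i]]_n -> R) X :
  matrix_norm nrm -> nrm (- X) = nrm X.
Proof.
move=> nrmP; have := matrix_normZ nrmP (-1) X.
(* Homogeneity is an equation in [R[i]]; its real part is the claim. *)
by rewrite scaleN1r normrN1 mul1r => -[].
Qed.

Lemma matrix_normB (R : realType) (n : nat) (nrm : 'M[R[i]]_n -> R) X Y :
  matrix_norm nrm -> nrm (X - Y) <= nrm X + nrm Y.
Proof. by move=> nrmP; rewrite -(matrix_normN Y nrmP) matrix_normD. Qed.

(** The order of the factors matters in the residual but not in its bound, so
    [D^2 E] and [E D E] become commuting monomials in the real numbers [e] and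
    [d], where they are dominated by the expansion of the cube. *)
Lemma matrix_norm_residual_le (R : realType) (n : nat)
    (nrm : 'M[R[i]]_n -> R) D E :
  matrix_norm nrm -> submultiplicative nrm ->
  nrm (- E ^+ 2 - E *m D - D ^+ 2 - D ^+ 2 *m E - E *m D *m E)
    <= (nrm E + nrm D) ^+ 2 + (nrm E + nrm D) ^+ 3.
Proof.
move=> nrmP nrmM.
set e := nrm E; set d := nrm D.
have e0 : 0 <= e by exact: matrix_norm_ge0.
have d0 : 0 <= d by exact: matrix_norm_ge0.
have nrmM3 X Y Z : nrm (X *m Y *m Z) <= nrm X * nrm Y * nrm Z.
  apply: le_trans (nrmM _ _) _.
  by rewrite ler_wpM2r ?nrmM ?(matrix_norm_ge0 nrmP).
have triangle : nrm (- E ^+ 2 - E *m D - D ^+ 2 - D ^+ 2 *m E - E *m D *m E)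
    <= e * e + e * d + d * d + d * d * e + e * d * e.
  do 4![apply: le_trans (matrix_normB _ _ nrmP) _; apply: lerD;
      last by first [exact: nrmM | exact: nrmM3]].
  by rewrite matrix_normN //; exact: nrmM.
apply: le_trans triangle _; rewrite -subr_ge0.
(* The slack is a polynomial in [e] and [d] with nonnegative coefficients. *)
have -> : (e + d) ^+ 2 + (e + d) ^+ 3
    - (e * e + e * d + d * d + d * d * e + e * d * e)
  = e * d + e ^+ 3 + 2 * (e * e * d) + 2 * (e * d * d) + d ^+ 3 by ring.
by rewrite !(addr_ge0, mulr_ge0, exprn_ge0).
Qed.

Theorem proposition3 (R : realType) (n : nat) (V W : 'M[R[i]]_n)
    (hV : V \in unitmx) (E F : 'M[R[i]]_n)
    (hF : F ^t* = 1%:M - W ^t* *m V - E) :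
  let D := W ^t* *m V - 1%:M in
  let V' := V *m (1%:M + E) in
  let W' := W *m (1%:M + F) in
  let D' := W' ^t* *m V' - 1%:M in
  [/\ F ^t* = - D - E,
      D' = - E ^+ 2 - E *m D - D ^+ 2 - D ^+ 2 *m E - E *m D *m E,
      forall nrm : 'M[R[i]]_n -> R, matrix_norm nrm -> submultiplicative nrm ->
        nrm D' <= (nrm E + nrm D) ^+ 2 + (nrm E + nrm D) ^+ 3
    & E = 0 -> W' ^t* *m V = 1%:M - D ^+ 2].
Proof.
move=> D V' W' D'.
have FE : F ^t* = - D - E by rewrite hF opprB.
have WV : W ^t* *m V = 1%:M + D by rewrite addrC subrK.
have W'V : W' ^t* *m V = (1%:M - D - E) *m (1%:M + D).
  rewrite -WV /W' trmx_mul map_mxM linearD /= map_mxD trmx1 map_mx1 FE.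
  by rewrite addrA mulmxA.
have D'E : D' = - E ^+ 2 - E *m D - D ^+ 2 - D ^+ 2 *m E - E *m D *m E.
  by rewrite /D' /V' mulmxA W'V; exact: corrected_mul1D_mul1D.
split=> // [nrm nrmP nrmM|E0].
  by rewrite D'E; exact: matrix_norm_residual_le.
by rewrite W'V; have := corrected_mul1D D E; rewrite E0 mul0r !subr0.
Qed.
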